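(* There is an absolute constant $C>0$ such that the following holds. Let $A\in\mathbb{R}^{m\times n}$ have full row rank $m\le n$, let $b\in\mathbb{R}^m$, $c\in\mathbb{R}^n$, let $\epsilon>0$, and let $(x_0,y_0,s_0)\in\mathcal{N}_2(0.25)$ be a feasible starting point (that is, $Ax_0=b$ and $A^Ty_0+s_0=c$) with duality measure $\mu_0\ge 2\epsilon$. Run the inexact predictor-corrector algorithm (described in the context) from $(x_0,y_0,s_0)$, where the approximate solver $\mathsf{Solve}$ is called twice in each outer iteration with error tolerance $$\delta=\min\left\{\frac{\sqrt{\epsilon}}{2^6},\ \frac{\epsilon\, C_0}{2\sqrt{n}\,\log(\mu_0/\epsilon)}\right\},$$ where $C_0\in(0,1)$ is the absolute constant specified in the context. Then, after at most $C\sqrt{n}\,\log(\mu_0/\epsilon)$ outer iterations, the algorithm terminates at a dual-feasible point $(x^*,y^*,s^* )$ (that is, $A^Ty^*+s^*=c$, $s^*\ge 0$) whose duality measure $\mu^*=\frac1n (x^* )^Ts^*$ satisfies $\mu^*<2\epsilon$ and for which $\|Ax^*-b\|_2<\epsilon$.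
   Context: The linear program is $\min c^Tx$ subject to $Ax=b$, $x\ge 0$, with dual $\max b^Ty$ subject to $A^Ty+s=c$, $s\ge0$. Notation. $\mathbf{1}_n$ is the all-ones vector, $\circ$ the entrywise product, $M^\dagger$ the Moore–Penrose pseudoinverse, and $\|z\|_M=\sqrt{z^TMz}$ for symmetric positive definite $M$. For a point $(x,y,s)$ with $x,s\in\mathbb{R}^n$ entrywise positive and $y\in\mathbb{R}^m$: $X=\mathrm{diag}(x)$, $S=\mathrm{diag}(s)$, $D=X^{1/2}S^{-1/2}$ (so $D^2=XS^{-1}$), and the duality measure is $\mu=\frac1n x^Ts$. For $\theta\in(0,1)$, $\mathcal{N}_2(\theta)=\{(x,y,s)\in\mathbb{R}^{n}\times\mathbb{R}^m\times\mathbb{R}^n:\ \|x\circ s-\mu\mathbf{1}_n\|_2\le\theta\mu,\ (x,s)>0\}$. Solver. $\mathsf{Solve}(AD^2A^T,p,\delta)$ returns any vector $\widetilde{\Delta y}$ with $\|\widetilde{\Delta y}-(AD^2A^T)^{-1}p\|_{AD^2A^T}\le\delta$ and $\|AD^2A^T\widetilde{\Delta y}-p\|_2\le\delta$. Inexact step. For centering parameter $\sigma\in[0,1]$, given $\widetilde{\Delta y}$, set $\widetilde{\Delta s}=-A^T\widetilde{\Delta y}$ and $\widetilde{\Delta x}=-x+\sigma\mu S^{-1}\mathbf{1}_n-D^2\widetilde{\Delta s}$. The residual vector is $f=-\sigma\mu AS^{-1}\mathbf{1}_n+Ax-AD^2A^T\widetilde{\Delta y}$. Algorithm. Start at $(x_0,y_0,s_0)$.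 While the current iterate has $\mu\ge2\epsilon$, perform one outer iteration: Predictor step ($\sigma=0$): compute $\widetilde{\Delta y}=\mathsf{Solve}(AD^2A^T,Ax,\delta)$ and then $\widetilde{\Delta s}=-A^T\widetilde{\Delta y}$ and $\widetilde{\Delta x}=-x-D^2\widetilde{\Delta s}$ (the inexact step with $\sigma=0$); set $\alpha=\min\{\frac12,(\mu/(16\|\widetilde{\Delta x}\circ\widetilde{\Delta s}\|_2))^{1/2}\}$ (with $\alpha=\frac12$ if $\widetilde{\Delta x}\circ\widetilde{\Delta s}=0$); replace $(x,y,s)$ by $(x,y,s)+\alpha(\widetilde{\Delta x},\widetilde{\Delta y},\widetilde{\Delta s})$. Corrector step ($\sigma=1$): with $D,S,\mu$ recomputed at the new point, compute $\widetilde{\Delta y}=\mathsf{Solve}(AD^2A^T,-\mu AS^{-1}\mathbf{1}_n+Ax,\delta)$ and then $\widetilde{\Delta s},\widetilde{\Delta x}$ with $\sigma=1$; replace $(x,y,s)$ by $(x,y,s)+(\widetilde{\Delta x},\widetilde{\Delta y},\widetilde{\Delta s})$. The constant $C_0\in(0,1)$ is an absolute constant (independent of all data) with the following property (such a constant exists): for all $m\le n$, all full-row-rank $A\in\mathbb{R}^{m\times n}$, all $(x,y,s)\in\mathcal{N}_2(0.25)$, and every inexact step with $\sigma=0$ whose residual $f$ satisfies $\|(AD)^\dagger f\|_2\le\sqrt{\mu}/8$, with $\alpha$ chosen as in the predictor step, one has $\frac1n(x+\alpha\widetilde{\Delta x})^T(s+\alpha\widetilde{\Delta s})\le(1-C_0/\sqrt{n})\,\mu$.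 *)

(* Defs.v *)
From HB Require Import structures.
From mathcomp Require Import all_boot all_order all_algebra.
From mathcomp Require Import boolp classical_sets reals exp.

Set Implicit Arguments.
Unset Strict Implicit.
Unset Printing Implicit Defensive.

Import Order.TTheory GRing.Theory Num.Theory.
Local Open Scope classical_set_scope.
Local Open Scope ring_scope.

Section Vectors.
Context {R : realType}.

(* The library norm on matrices is the max norm, hence the Euclidean one here. *)
Definition norm2 n (z : 'cV[R]_n) : R := Num.sqrt ((z^T *m z) 0 0).

Definition norm_mx n (M : 'M[R]_n) (z : 'cV[R]_n) : R :=
  Num.sqrt ((z^T *m M *m z) 0 0).

Definition hadamard n (u v : 'cV[R]_n) : 'cV[R]_n := map2_mx *%R u v.

Definition vpos n (v : 'cV[R]_n) : Prop := forall i, 0 < v i 0.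

Definition vnneg n (v : 'cV[R]_n) : Prop := forall i, 0 <= v i 0.

Definition is_mpinv m n (M : 'M[R]_(m, n)) (P : 'M[R]_(n, m)) : Prop :=
  [/\ M *m P *m M = M, P *m M *m P = P,
      (M *m P)^T = M *m P & (P *m M)^T = P *m M].

(* The Moore-Penrose pseudoinverse; MathComp's [pinvmx] is only a partial
   inverse and does not satisfy the symmetry conditions. *)
Definition mpinv m n (M : 'M[R]_(m, n)) : 'M[R]_(n, m) :=
  xget 0 [set P | is_mpinv M P].

End Vectors.

Record lp_point (R : realType) (m n : nat) := LpPoint {
  px : 'cV[R]_n;
  py : 'cV[R]_m;
  ps : 'cV[R]_n
}.

Section InteriorPoint.
Context {R : realType}.

Definition mu m n (z : lp_point R m n) : R := ((px z)^T *m ps z) 0 0 / n%:R.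

Definition nbhd2 m n (theta : R) (z : lp_point R m n) : Prop :=
  [/\ norm2 (hadamard (px z) (ps z) - const_mx (mu z)) <= theta * mu z,
      vpos (px z) & vpos (ps z)].

(* D = X^(1/2) S^(-1/2) *)
Definition scaling m n (z : lp_point R m n) : 'M[R]_n :=
  diag_mx (\row_i (Num.sqrt (px z i 0) / Num.sqrt (ps z i 0))).

(* A D^2 A^T *)
Definition normal_mx m n (A : 'M[R]_(m, n)) (z : lp_point R m n) : 'M[R]_m :=
  A *m (scaling z *m scaling z) *m A^T.

(* S^(-1) 1_n *)
Definition sinv m n (z : lp_point R m n) : 'cV[R]_n := map_mx GRing.inv (ps z).

Definition normal_rhs m n (A : 'M[R]_(m, n)) (sigma : R) (z : lp_point R m n) :
    'cV[R]_m :=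
  - ((sigma * mu z) *: (A *m sinv z)) + A *m px z.

Definition solve_spec m (M : 'M[R]_m) (p : 'cV[R]_m) (delta : R)
    (dy : 'cV[R]_m) : Prop :=
  norm_mx M (dy - invmx M *m p) <= delta /\ norm2 (M *m dy - p) <= delta.

(* A solver is an arbitrary oracle.  Its first argument is the index of the
   call, so that successive calls, even on equal inputs, may return different
   vectors.  Nothing is assumed about it outside the systems A D^2 A^T coming
   from entrywise positive x and s. *)
Definition is_solver m n (A : 'M[R]_(m, n))
    (solve : nat -> 'M[R]_m -> 'cV[R]_m -> R -> 'cV[R]_m) : Prop :=
  forall (i : nat) (z : lp_point R m n) (p : 'cV[R]_m) (delta : R),
    vpos (px z) -> vpos (ps z) -> 0 < delta ->
    solve_spec (normal_mx A z) p delta (solve i (normal_mx A z) p delta).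

Definition step_s m n (A : 'M[R]_(m, n)) (dy : 'cV[R]_m) : 'cV[R]_n :=
  - (A^T *m dy).

Definition step_x m n (A : 'M[R]_(m, n)) (sigma : R) (z : lp_point R m n)
    (dy : 'cV[R]_m) : 'cV[R]_n :=
  - px z + (sigma * mu z) *: sinv z
  - scaling z *m scaling z *m step_s A dy.

Definition residual m n (A : 'M[R]_(m, n)) (sigma : R) (z : lp_point R m n)
    (dy : 'cV[R]_m) : 'cV[R]_m :=
  - ((sigma * mu z) *: (A *m sinv z)) + A *m px z - normal_mx A z *m dy.

Definition move m n (A : 'M[R]_(m, n)) (sigma alpha : R) (z : lp_point R m n)
    (dy : 'cV[R]_m) : lp_point R m n :=
  LpPoint (px z + alpha *: step_x A sigma z dy)
          (py z + alpha *: dy)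
          (ps z + alpha *: step_s A dy).

Definition predictor_alpha m n (A : 'M[R]_(m, n)) (z : lp_point R m n)
    (dy : 'cV[R]_m) : R :=
  let v := hadamard (step_x A 0 z dy) (step_s A dy) in
  if v == 0 then 1 / 2
  else Num.min (1 / 2) (Num.sqrt (mu z / (16 * norm2 v))).

Definition predictor_move m n (A : 'M[R]_(m, n)) (z : lp_point R m n)
    (dy : 'cV[R]_m) : lp_point R m n :=
  move A 0 (predictor_alpha A z dy) z dy.

Definition corrector_move m n (A : 'M[R]_(m, n)) (z : lp_point R m n)
    (dy : 'cV[R]_m) : lp_point R m n :=
  move A 1 1 z dy.

Definition predictor_decrease (C0 : R) : Prop :=
  forall (m n : nat) (A : 'M[R]_(m, n)) (z : lp_point R m n) (dy : 'cV[R]_m),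
    (m <= n)%N -> row_free A -> nbhd2 (1 / 4) z ->
    norm2 (mpinv (A *m scaling z) *m residual A 0 z dy)
      <= Num.sqrt (mu z) / 8 ->
    mu (predictor_move A z dy) <= (1 - C0 / Num.sqrt n%:R) * mu z.

Section Algorithm.
Variables (m n : nat) (A : 'M[R]_(m, n)).
Variables (solve : nat -> 'M[R]_m -> 'cV[R]_m -> R -> 'cV[R]_m) (delta : R).

(* Outer iteration number k makes the solver calls 2k and 2k+1. *)
Definition outer_iteration (k : nat) (z : lp_point R m n) : lp_point R m n :=
  let z' := predictor_move A z
    (solve k.*2 (normal_mx A z) (normal_rhs A 0 z) delta) in
  corrector_move A z'
    (solve k.*2.+1 (normal_mx A z') (normal_rhs A 1 z') delta).

Fixpoint iterates (z0 : lp_point R m n) (k : nat) : lp_point R m n :=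
  if k is k'.+1 then outer_iteration k' (iterates z0 k') else z0.

(* The loop "while mu >= 2 eps" started at z0 performs exactly K outer
   iterations and stops at z. *)
Definition terminates_at (eps : R) (z0 : lp_point R m n) (K : nat)
    (z : lp_point R m n) : Prop :=
  [/\ forall k, (k < K)%N -> 2 * eps <= mu (iterates z0 k),
      mu (iterates z0 K) < 2 * eps
    & z = iterates z0 K].

End Algorithm.

Definition tolerance (C0 eps mu0 : R) (n : nat) : R :=
  Num.min (Num.sqrt eps / 2 ^+ 6)
          (eps * C0 / (2 * Num.sqrt n%:R * ln (mu0 / eps))).

End InteriorPoint.

(* Main.v *)
Require Import Defs.
From HB Require Import structures.
From mathcomp Require Import all_boot all_order all_algebra.
From mathcomp Require Import ring lra.
From mathcomp Require Import boolp classical_sets reals exp.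

(* For an inexact step the linearised complementarity equation
   s o dx + x o ds = -x o s + sigma mu 1 is still exact, and only
   dx^T ds = f^T dy is perturbed, by at most delta rho + delta^2 where rho is
   the norm of (x o s)^(1/2) - sigma mu (x o s)^(-1/2).  Since each entry of
   dx o ds is at most a quarter of the corresponding squared entry of that
   vector, dx o ds has norm at most (10/7) (rho^2/4 + delta rho + delta^2).
   Hence the predictor step stays in N_2(1/2) with alpha >= (2/5) / sqrt n, the
   corrector step returns to N_2(1/4), and an outer iteration multiplies mu by
   at most 1 - (14/15) alpha.  Such an iteration moves A x by at most
   (1 + alpha) delta, and 1 + alpha <= (15/4) sqrt n (ln mu - ln mu'), so both
   the number of iterations and the total infeasibility telescope.  The assumed
   predictor decrease is only needed for C0 <= 1/2, which makes
   (15/4) sqrt n L delta <= (15/16) eps for L = log (mu0 / eps). *)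

Set Implicit Arguments.
Unset Strict Implicit.
Unset Printing Implicit Defensive.

Import Order.TTheory GRing.Theory Num.Theory.
Local Open Scope ring_scope.

(** * Euclidean norm: Cauchy-Schwarz, centering and sums of squares *)

Section Euclidean.
Context {R : realType}.

Lemma dotE n (u v : 'cV[R]_n) : (u^T *m v) 0 0 = \sum_i u i 0 * v i 0.
Proof. by rewrite mxE; apply: eq_bigr => i _; rewrite mxE. Qed.

Lemma norm2_ge0 n (u : 'cV[R]_n) : 0 <= norm2 u.
Proof. exact: sqrtr_ge0. Qed.

Lemma sqr_norm2 n (u : 'cV[R]_n) : norm2 u ^+ 2 = \sum_i u i 0 ^+ 2.
Proof.
rewrite sqr_sqrtr dotE; last by apply: sumr_ge0 => i _; rewrite -expr2 sqr_ge0.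
by apply: eq_bigr => i _; rewrite expr2.
Qed.

Lemma norm2_le n (u : 'cV[R]_n) a :
  0 <= a -> \sum_i u i 0 ^+ 2 <= a ^+ 2 -> norm2 u <= a.
Proof.
by move=> a0; rewrite -sqr_norm2 ler_pXn2r// ?nnegrE ?norm2_ge0.
Qed.

Lemma norm2_0 n : norm2 (0 : 'cV[R]_n) = 0.
Proof. by rewrite /norm2 mulmx0 mxE sqrtr0. Qed.

Lemma norm2Z n a (u : 'cV[R]_n) : norm2 (a *: u) = `|a| * norm2 u.
Proof.
rewrite /norm2 !dotE (eq_bigr (fun i => a ^+ 2 * (u i 0 * u i 0))).
  by rewrite -mulr_sumr sqrtrM ?sqr_ge0// sqrtr_sqr.
by move=> i _; rewrite !mxE; ring.
Qed.

Lemma norm2N n (u : 'cV[R]_n) : norm2 (- u) = norm2 u.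
Proof. by rewrite -scaleN1r norm2Z normrN1 mul1r. Qed.

Lemma norm2_gt0 n (u : 'cV[R]_n) : u != 0 -> 0 < norm2 u.
Proof.
apply: contra_neqT; rewrite -leNgt => u0; apply/matrixP => i j.
rewrite ord1 mxE; apply/eqP; rewrite -sqrf_eq0.
have := sqr_norm2 u; rewrite (_ : norm2 u = 0); last first.
  by apply/eqP; rewrite eq_le u0 norm2_ge0.
rewrite expr0n => /esym/eqP; rewrite psumr_eq0 => [|k _]; last exact: sqr_ge0.
by move=> /allP/(_ i); rewrite mem_index_enum => /(_ isT).
Qed.

Lemma norm2_ge_coord n (u : 'cV[R]_n) i : `|u i 0| <= norm2 u.
Proof.
rewrite -(@ler_pXn2r _ 2)// ?nnegrE ?norm2_ge0// sqr_norm2 (bigD1 i)//=.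
by rewrite real_normK ?num_real// lerDl sumr_ge0// => j _; exact: sqr_ge0.
Qed.

(** With [B = |v|^2] and [c = u^T v], the squared norm of [B u - c v] expands to
    [B (|u|^2 B - c^2)]. *)
Lemma sqr_dot_le n (u v : 'cV[R]_n) :
  (\sum_i u i 0 * v i 0) ^+ 2 <= norm2 u ^+ 2 * norm2 v ^+ 2.
Proof.
have [->|/norm2_gt0 v0] := eqVneq v 0.
  by rewrite big1 ?expr0n -?exprMn ?sqr_ge0// => i _; rewrite mxE mulr0.
set B := norm2 v ^+ 2; set c := \sum_i _.
have B0 : 0 < B by rewrite exprn_gt0.
suff : 0 <= B * (norm2 u ^+ 2 * B - c ^+ 2) by rewrite pmulr_rge0// subr_ge0.
have -> : B * (norm2 u ^+ 2 * B - c ^+ 2)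
    = \sum_i (B * u i 0 - c * v i 0) ^+ 2.
  under eq_bigr => i _.
    rewrite (_ : _ ^+ 2 = B ^+ 2 * u i 0 ^+ 2
        + (- (2 * B * c) * (u i 0 * v i 0) + c ^+ 2 * v i 0 ^+ 2));
      last by ring.
    over.
  rewrite !big_split/= -!mulr_sumr -!sqr_norm2 -/c -/B; ring.
by apply: sumr_ge0 => i _; exact: sqr_ge0.
Qed.

Lemma dot_le n (u v : 'cV[R]_n) :
  `|\sum_i u i 0 * v i 0| <= norm2 u * norm2 v.
Proof.
rewrite -(@ler_pXn2r _ 2)// ?nnegrE ?mulr_ge0 ?norm2_ge0//.
by rewrite real_normK ?num_real// exprMn sqr_dot_le.
Qed.

Lemma ler_norm2D n (u v : 'cV[R]_n) : norm2 (u + v) <= norm2 u + norm2 v.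
Proof.
apply: norm2_le; first by rewrite addr_ge0 ?norm2_ge0.
under eq_bigr => i _.
  rewrite (_ : _ ^+ 2 = u i 0 ^+ 2 + (2 * (u i 0 * v i 0) + v i 0 ^+ 2));
    last by rewrite mxE; ring.
  over.
rewrite !big_split/= -mulr_sumr -!sqr_norm2.
have := dot_le u v; rewrite ler_norml => /andP[_]; nra.
Qed.

(* Subtracting the mean is an orthogonal projection. *)
Lemma norm2_center n (u : 'cV[R]_n) :
  norm2 (u - const_mx ((\sum_i u i 0) / n%:R)) <= norm2 u.
Proof.
(* For [n = 0] the mean is a division by zero, but both norms are empty sums. *)
case: n u => [|n] u; first by rewrite /norm2 !dotE !big_ord0.
apply: norm2_le; first exact: norm2_ge0.
set a := _ / _; have aE : \sum_i u i 0 = n.+1%:R * a.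
  by rewrite /a mulrC divfK// pnatr_eq0.
under eq_bigr => i _.
  rewrite (_ : _ ^+ 2 = u i 0 ^+ 2 + (- (2 * a) * u i 0 + a ^+ 2));
    last by rewrite !mxE; ring.
  over.
rewrite !big_split/= -mulr_sumr aE -sqr_norm2 sumr_const card_ord -mulr_natl.
have : 0 <= n.+1%:R * a ^+ 2 by rewrite mulr_ge0 ?sqr_ge0.
nra.
Qed.

Lemma sum_sqr_le (I : finType) (a : I -> R) :
  (forall i, 0 <= a i) -> \sum_i a i ^+ 2 <= (\sum_i a i) ^+ 2.
Proof.
move=> a0; rewrite [leRHS]expr2 mulr_suml; apply: ler_sum => i _.
by rewrite expr2 ler_wpM2l// (bigD1 i)//= lerDl sumr_ge0.
Qed.

(* The positive entries sum to at most q, hence the negative ones to at most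
   q - g in absolute value. *)
Lemma sum_sqr_le_pos_neg (I : finType) (v a : I -> R) (q g : R) :
  (forall i, 0 <= a i) -> (forall i, v i <= a i) -> \sum_i a i <= q ->
  g <= \sum_i v i -> \sum_i v i ^+ 2 <= q ^+ 2 + (q - g) ^+ 2.
Proof.
move=> a0 va aq gv.
pose p i := Num.max (v i) 0; pose m i := Num.max (- v i) 0.
have p0 i : 0 <= p i by rewrite le_max lexx orbT.
have m0 i : 0 <= m i by rewrite le_max lexx orbT.
have pmE i : (v i = p i - m i) * (v i ^+ 2 = p i ^+ 2 + m i ^+ 2).
  rewrite /p /m; have [h|/ltW h] := lerP (v i) 0.
    by rewrite max_l ?oppr_ge0//; split; ring.
  by rewrite max_r ?oppr_le0//; split; ring.
have pq : \sum_i p i <= q.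
  by apply: le_trans aq; apply: ler_sum => i _; rewrite ge_max va a0.
have mq : \sum_i m i <= q - g.
  have : \sum_i v i = \sum_i p i - \sum_i m i.
    by rewrite -sumrB; apply: eq_bigr => i _; rewrite pmE.
  lra.
under eq_bigr do rewrite pmE.
rewrite big_split/=; apply: lerD; apply: (le_trans (sum_sqr_le _)) => //.
- rewrite ler_pXn2r// nnegrE; first exact: sumr_ge0.
  by apply: le_trans pq; exact: sumr_ge0.
- rewrite ler_pXn2r// nnegrE; first exact: sumr_ge0.
  by apply: le_trans mq; exact: sumr_ge0.
Qed.

End Euclidean.

(** * The normal matrix and the inexact directions *)

Section NormalEquations.
Context {R : realType} (m n : nat) (A : 'M[R]_(m, n)) (z : lp_point R m n).
Hypotheses (hA : row_free A) (x_gt0 : vpos (px z)) (s_gt0 : vpos (ps z)).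

Local Notation D := (scaling z).

Lemma scaling_mulE (v : 'cV[R]_n) i :
  (D *m v) i 0 = Num.sqrt (px z i 0) / Num.sqrt (ps z i 0) * v i 0.
Proof. by rewrite /scaling mul_diag_mx !mxE. Qed.

Lemma scaling_sqr_mulE (v : 'cV[R]_n) i :
  (D *m D *m v) i 0 = px z i 0 / ps z i 0 * v i 0.
Proof.
rewrite -mulmxA !scaling_mulE mulrA; congr (_ * _).
by rewrite mulrACA -invfM -!expr2 !sqr_sqrtr// ltW.
Qed.

Lemma trmx_scaling : D^T = D.
Proof. exact: tr_diag_mx. Qed.

(** [D] is symmetric, so [A D^2 A^T] is the Gram matrix of [D A^T]. The energy-norm error of the
    solver thus becomes a Euclidean length. *)
Lemma norm_normal_mx (e : 'cV[R]_m) :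
  norm_mx (normal_mx A z) e = norm2 (D *m (A^T *m e)).
Proof.
rewrite /norm_mx /norm2 /normal_mx !trmx_mul trmxK trmx_scaling.
by rewrite !mulmxA.
Qed.

(** A kernel vector [u] satisfies [D A^T u^T = 0]; the positive diagonal of [D] and the full row
    rank of [A] force [u = 0]. *)
Lemma normal_mx_unit : normal_mx A z \in unitmx.
Proof.
rewrite -row_free_unit -kermx_eq0; apply/rowV0P => u /sub_kermxP uM.
have [->//|u0] := eqVneq u 0.
have h0 : norm2 (D *m (A^T *m u^T)) = 0.
  by rewrite -norm_normal_mx /norm_mx trmxK uM mul0mx mxE sqrtr0.
have : A^T *m u^T = 0.
  apply/matrixP => i j; rewrite ord1 [RHS]mxE; apply/eqP.
  have := norm2_ge_coord (D *m (A^T *m u^T)) i.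
  rewrite h0 normr_le0 scaling_mulE mulf_eq0 mulf_eq0 invr_eq0 !sqrtr_eq0.
  by rewrite !leNgt x_gt0 s_gt0.
rewrite -trmx_mul => /(congr1 trmx); rewrite trmxK trmx0 => uA.
by case/eqP: u0; apply: (row_free_inj hA); rewrite uA mul0mx.
Qed.

Variables (sigma delta rho : R) (dy : 'cV[R]_m).

Local Notation x i := (px z i 0).
Local Notation s i := (ps z i 0).
Local Notation dx := (step_x A sigma z dy).
Local Notation ds := (step_s A dy).

Lemma step_xE i :
  dx i 0 = - x i + sigma * mu z / s i - x i / s i * ds i 0.
Proof.
by rewrite -(scaling_sqr_mulE ds) /step_x; set q := _ *m ds; rewrite !mxE. Qed.

(* The inexactness of dy only shows up in A dx, see [mulmx_step_x]. *)
Lemma step_compl i :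
  s i * dx i 0 + x i * ds i 0 = - (x i * s i) + sigma * mu z.
Proof.
have s0 : s i != 0 by rewrite gt_eqF.
by rewrite step_xE; field.
Qed.

(** An exact solve would give [A dx = 0]: all primal drift comes from the solver error. *)
Lemma mulmx_step_x : A *m dx = - residual A sigma z dy.
Proof.
rewrite /step_x /residual /normal_mx /step_s.
rewrite !(mulmxDr, mulmxN, mulmxA) -!scalemxAr !opprD !opprK.
by congr (_ + _); exact: addrC.
Qed.

Lemma sum_step : \sum_i dx i 0 * ds i 0 = ((residual A sigma z dy)^T *m dy) 0 0.
Proof.
rewrite -dotE /step_s mulmxN mulmxA -trmx_mul mulmx_step_x linearN/=.
by rewrite mulNmx opprK.
Qed.

(** With [e] the solver error, the residual is [- M e], whence [dx^T ds = - e^T M e - e^T p]. The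
    first term is [- |h|^2 <= 0], so [delta ^+ 2] enters only the lower bound; the second is
    [- h^T r], bounded by Cauchy-Schwarz. *)
Lemma sum_step_bounds :
  0 <= delta -> 0 <= rho ->
  \sum_i (x i * s i - sigma * mu z) ^+ 2 / (x i * s i) <= rho ^+ 2 ->
  norm_mx (normal_mx A z) (dy - invmx (normal_mx A z) *m normal_rhs A sigma z)
    <= delta ->
  - (delta * rho + delta ^+ 2) <= \sum_i dx i 0 * ds i 0 <= delta * rho.
Proof.
move=> delta_ge0 rho_ge0 w_le.
set M := normal_mx A z; set p := normal_rhs A sigma z.
set e := dy - invmx M *m p => dy_le.
have Me : residual A sigma z dy = - (M *m e).
  rewrite /e mulmxBr mulmxA mulmxV ?normal_mx_unit// mul1mx opprB.
  by rewrite /residual -/M -/p.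
pose h := D *m (A^T *m e).
(* [r] is [D^-1 (x - sigma mu s^-1)], so that [p = A D r]; its squared norm is the weighted sum in
   the hypothesis. *)
pose r : 'cV[R]_n := \col_i (Num.sqrt (x i * s i)
  - sigma * mu z / Num.sqrt (x i * s i)).
have xs_gt0 i : 0 < x i * s i by rewrite mulr_gt0.
have r_le : norm2 r <= rho.
  apply: norm2_le => //; apply: le_trans w_le; apply: ler_sum => i _.
  rewrite mxE; set q := Num.sqrt _.
  have q0 : q != 0 by rewrite gt_eqF// sqrtr_gt0.
  have <- : q ^+ 2 = x i * s i by rewrite sqr_sqrtr ?ltW.
  by rewrite le_eqVlt; apply/orP; left; apply/eqP; field.
have h_le : norm2 h <= delta by rewrite -norm_normal_mx.
have -> : \sum_i dx i 0 * ds i 0 = - norm2 h ^+ 2 - \sum_i h i 0 * r i 0.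
  rewrite sum_step Me.
  have -> : dy = e + invmx M *m p by rewrite /e subrK.
  have MT : M^T = M.
    by rewrite /M /normal_mx !trmx_mul trmxK trmx_scaling !mulmxA.
  rewrite linearN/= trmx_mul MT mulNmx mulmxDr.
  rewrite -(mulmxA e^T M (invmx M *m p)) mulKVmx ?normal_mx_unit//.
  rewrite mxE mxE opprD; congr (- _ - _).
    rewrite sqr_norm2 (eq_bigr (fun i => h i 0 * h i 0)) => [|i _]; last first.
      exact: expr2.
    by rewrite -dotE /h !trmx_mul trmxK trmx_scaling /M /normal_mx !mulmxA.
  have -> : p = A *m (px z - (sigma * mu z) *: sinv z).
    by rewrite mulmxBr -scalemxAr addrC.
  rewrite mulmxA -{1}(trmxK A) -trmx_mul dotE; apply: eq_bigr => i _.
  rewrite scaling_mulE mulrAC mulrC; congr (_ * _).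
  rewrite !mxE sqrtrM ?ltW//.
  set a := Num.sqrt (x i); set c := Num.sqrt (s i).
  have [xE sE] : x i = a ^+ 2 /\ s i = c ^+ 2 by rewrite !sqr_sqrtr ?ltW.
  have a0 : a != 0 by rewrite gt_eqF ?sqrtr_gt0.
  have c0 : c != 0 by rewrite gt_eqF ?sqrtr_gt0.
  by rewrite xE sE; field; rewrite a0 c0.
have := dot_le h r; rewrite ler_norml => /andP[].
have := norm2_ge0 h; have := norm2_ge0 r.
set a := norm2 h; set c := norm2 r; set d := \sum_i _ => c0 a0 ? ?.
have acd : a * c <= delta * rho by rewrite ler_pM.
have : 0 <= a ^+ 2 <= delta ^+ 2 by rewrite sqr_ge0 ler_pXn2r// nnegrE.
by move=> /andP[? ?]; apply/andP; split; lra.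
Qed.

(** * Size of the second-order term [dx o ds] *)

Local Notation v := (hadamard dx ds).

Lemma norm2_step_le :
  0 <= delta -> 0 <= rho ->
  \sum_i (x i * s i - sigma * mu z) ^+ 2 / (x i * s i) <= rho ^+ 2 ->
  norm_mx (normal_mx A z) (dy - invmx (normal_mx A z) *m normal_rhs A sigma z)
    <= delta ->
  norm2 v <= 10 / 7 * (rho ^+ 2 / 4 + delta * rho + delta ^+ 2).
Proof.
move=> delta_ge0 rho_ge0 w_le dy_le.
have /andP[g_ge _] := sum_step_bounds delta_ge0 rho_ge0 w_le dy_le.
have dr0 : 0 <= delta * rho by rewrite mulr_ge0.
have [r0 d0] : 0 <= rho ^+ 2 /\ 0 <= delta ^+ 2 by rewrite !sqr_ge0.
apply: norm2_le; first lra.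
have xs_gt0 i : 0 < x i * s i by rewrite mulr_gt0.
set a := fun i => (x i * s i - sigma * mu z) ^+ 2 / (x i * s i) / 4.
have a_ge0 i : 0 <= a i by rewrite !divr_ge0 ?sqr_ge0// ltW.
have va i : dx i 0 * ds i 0 <= a i.
  rewrite /a -mulrA -invfM ler_pdivlMr ?mulr_gt0//.
  (* AM-GM: 4 (s dx) (x ds) <= (s dx + x ds)^2 *)
  have -> : x i * s i - sigma * mu z = - (s i * dx i 0 + x i * ds i 0).
    by rewrite step_compl; ring.
  rewrite -subr_ge0.
  have -> : (- (s i * dx i 0 + x i * ds i 0)) ^+ 2
      - dx i 0 * ds i 0 * (x i * s i * 4)
      = (s i * dx i 0 - x i * ds i 0) ^+ 2 by ring.
  exact: sqr_ge0.
have aq : \sum_i a i <= rho ^+ 2 / 4.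
  by rewrite -mulr_suml ler_pM2r// invr_gt0.
under eq_bigr do rewrite mxE.
(* With [q = rho^2 / 4] and [g <= 0], the bound [q^2 + (q - g)^2] is at most [2 (q - g)^2], and
   [10 / 7] is a rational majorant of the square root of 2. *)
apply: le_trans (sum_sqr_le_pos_neg a_ge0 va aq g_ge) _; nra.
Qed.

(** * Complementarity, positivity and centrality after a step of length [alpha] *)

Variable alpha : R.
Local Notation z' := (move A sigma alpha z dy).

Lemma move_xs i : px z' i 0 * ps z' i 0 =
  (1 - alpha) * (x i * s i) + alpha * sigma * mu z
    + alpha ^+ 2 * (dx i 0 * ds i 0).
Proof.
have -> : px z' i 0 * ps z' i 0
    = (x i + alpha * dx i 0) * (s i + alpha * ds i 0).
  by rewrite /move; set dx' := dx; set ds' := ds; cbn [px ps]; rewrite !mxE.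
have := step_compl i; set a := dx i 0; set b := ds i 0 => h.
have -> : (x i + alpha * a) * (s i + alpha * b) =
  x i * s i + alpha * (s i * a + x i * b) + alpha ^+ 2 * (a * b) by ring.
by rewrite h; ring.
Qed.

Hypothesis n_gt0 : (0 < n)%N.

Lemma sum_xs : \sum_i x i * s i = n%:R * mu z.
Proof. by rewrite /mu dotE mulrC divfK// pnatr_eq0 -lt0n. Qed.

Lemma mu_gt0 : 0 < mu z.
Proof.
have n0 : 0 < n%:R :> R by rewrite ltr0n.
rewrite -(pmulr_rgt0 _ n0) -sum_xs (bigD1 (Ordinal n_gt0))//=.
by rewrite ltr_pwDl ?mulr_gt0// sumr_ge0// => i _; rewrite mulr_ge0 ?ltW.
Qed.

Lemma mu_move : mu z' = (1 - alpha + alpha * sigma) * mu z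
  + alpha ^+ 2 * ((\sum_i dx i 0 * ds i 0) / n%:R).
Proof.
have n0 : n%:R != 0 :> R by rewrite pnatr_eq0 -lt0n.
rewrite {1}/mu dotE; under eq_bigr do rewrite move_xs.
have cE : \sum_(i < n) alpha * sigma * mu z = n%:R * (alpha * sigma * mu z).
  by rewrite sumr_const card_ord mulr_natl.
rewrite !big_split/= cE -!mulr_sumr sum_xs.
by field.
Qed.

(** At [alpha] alone, a positive product could have two negative factors, hence the condition along
    the whole segment. An affine factor that loses positivity vanishes somewhere on it, and so does
    the product. *)
Lemma move_pos :
  0 <= alpha ->
  (forall i (t : R), 0 <= t <= alpha ->
    0 < (1 - t) * (x i * s i) + t * sigma * mu z
      + t ^+ 2 * (dx i 0 * ds i 0)) ->
  vpos (px z') /\ vpos (ps z').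
Proof.
move=> alpha_ge0 path_pos.
have prodE i t : (x i + t * dx i 0) * (s i + t * ds i 0) =
    (1 - t) * (x i * s i) + t * sigma * mu z + t ^+ 2 * (dx i 0 * ds i 0).
  have := step_compl i; set a := dx i 0; set b := ds i 0 => h.
  have -> : (x i + t * a) * (s i + t * b) =
    x i * s i + t * (s i * a + x i * b) + t ^+ 2 * (a * b) by ring.
  by rewrite h; ring.
have lin_pos (a b : R) : 0 < a ->
    (forall t : R, 0 <= t <= alpha -> a + t * b != 0) -> 0 < a + alpha * b.
  move=> a0 ab; rewrite ltNge; apply/negP => ab_le0.
  have b0 : b < 0.
    by rewrite ltNge; apply/negP => b0; have := mulr_ge0 alpha_ge0 b0; lra.
  have nb : 0 < - b by rewrite oppr_gt0.
  (* The explicit root of [a + t * b]. *)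
  have t01 : 0 <= a / - b <= alpha.
    by rewrite divr_ge0 ?(ltW a0) ?(ltW nb)//= ler_pdivrMr//; lra.
  by move/eqP : (ab _ t01); apply; field; rewrite lt_eqF.
split=> i.
- have -> : px z' i 0 = x i + alpha * dx i 0.
    by rewrite /move; set dx' := dx; cbn [px]; rewrite !mxE.
  apply: lin_pos => // t /(path_pos i); rewrite -prodE.
  by apply: contraTneq => ->; rewrite mul0r ltxx.
- have -> : ps z' i 0 = s i + alpha * ds i 0.
    by rewrite /move; set ds' := ds; cbn [ps]; rewrite !mxE.
  apply: lin_pos => // t /(path_pos i); rewrite -prodE.
  by apply: contraTneq => ->; rewrite mulr0 ltxx.
Qed.

(** The shift [sigma mu] is the same in every coordinate and cancels against the mean; what remains
    is [1 - alpha] times the old deviation plus [alpha^2] times the centered [v]. *)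
Lemma move_dev :
  0 <= alpha <= 1 ->
  norm2 (hadamard (px z') (ps z') - const_mx (mu z')) <=
  (1 - alpha) * norm2 (hadamard (px z) (ps z) - const_mx (mu z))
    + alpha ^+ 2 * norm2 v.
Proof.
move=> /andP[alpha_ge0 alpha_le1].
set d := hadamard (px z) (ps z) - _.
have -> : hadamard (px z') (ps z') - const_mx (mu z') = (1 - alpha) *: d
    + alpha ^+ 2 *: (v - const_mx ((\sum_i v i 0) / n%:R)).
  have -> : \sum_i v i 0 = \sum_i dx i 0 * ds i 0.
    by apply: eq_bigr => i _; rewrite mxE.
  apply/matrixP => i j; rewrite ord1.
  transitivity (px z' i 0 * ps z' i 0 - mu z').
    by set a := px z'; set b := ps z'; set c := mu z'; rewrite !mxE.
  rewrite move_xs mu_move /d.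
  by set a := dx; set b := ds; set c := \sum_i _; rewrite !mxE; ring.
apply: le_trans (ler_norm2D _ _) _; rewrite !norm2Z.
rewrite ger0_norm ?subr_ge0// (ger0_norm (sqr_ge0 _)) lerD2l.
by apply: ler_wpM2l; rewrite ?sqr_ge0// norm2_center.
Qed.

End NormalEquations.

(** * Predictor and corrector steps between the two neighbourhoods *)

Lemma nbhd2_xs (R : realType) m n theta (z : lp_point R m n) i :
  nbhd2 theta z -> (1 - theta) * mu z <= px z i 0 * ps z i 0.
Proof.
case=> dev _ _.
have := norm2_ge_coord (hadamard (px z) (ps z) - const_mx (mu z)) i.
by rewrite !mxE ler_norml => /andP[]; lra.
Qed.

Lemma predictor_step (R : realType) m n (A : 'M[R]_(m, n))
    (z : lp_point R m n) (delta : R) (dy : 'cV[R]_m) :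
  (0 < n)%N -> row_free A -> 0 <= delta ->
  nbhd2 (1 / 4) z -> delta ^+ 2 <= mu z / 8100 ->
  norm_mx (normal_mx A z) (dy - invmx (normal_mx A z) *m normal_rhs A 0 z)
    <= delta ->
  [/\ nbhd2 (1 / 2) (predictor_move A z dy),
      2 / 5 / Num.sqrt n%:R <= predictor_alpha A z dy <= 1 / 2,
      mu (predictor_move A z dy)
        <= (1 - 179 / 180 * predictor_alpha A z dy) * mu z
    & 7 / 16 * mu z <= mu (predictor_move A z dy)].
Proof.
move=> n_gt0 hA delta_ge0 zN delta_le dy_le; have [dev x0 s0] := zN.
rewrite /predictor_move; set alpha := predictor_alpha A z dy.
set z' := move _ _ _ _ _.
have M0 := mu_gt0 x0 s0 n_gt0; set M := mu z in M0 *.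
pose N : R := Num.sqrt n%:R; pose t := Num.sqrt M.
have t0 : 0 < t by rewrite sqrtr_gt0.
have tE : t ^+ 2 = M by rewrite sqr_sqrtr// ltW.
have NE : N ^+ 2 = n%:R by rewrite sqr_sqrtr.
have N1 : 1 <= N by rewrite -sqrtr1 ler_wsqrtr// ler1n.
have dt : delta <= t / 90.
  rewrite -(@ler_pXn2r _ 2)// ?nnegrE ?divr_ge0 ?(ltW t0)//.
  by rewrite expr_div_n tE; move: delta_le; rewrite -/M; lra.
have Nt0 : 0 <= N * t by rewrite mulr_ge0 ?(ltW t0)// (le_trans ler01).
(* For [sigma = 0] the weighted sum is [x^T s = n mu], so [rho = N * t]. *)
have w_le : \sum_i (px z i 0 * ps z i 0 - 0 * M) ^+ 2 / (px z i 0 * ps z i 0)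
    <= (N * t) ^+ 2.
  rewrite exprMn NE tE -sum_xs//; apply: ler_sum => i _.
  have : px z i 0 * ps z i 0 != 0 by rewrite gt_eqF ?mulr_gt0.
  set a := px z i 0 * _ => a0.
  by rewrite le_eqVlt; apply/orP; left; apply/eqP; field.
have v_le := norm2_step_le hA x0 s0 delta_ge0 Nt0 w_le dy_le.
have /andP[g_ge g_le] := sum_step_bounds hA x0 s0 delta_ge0 Nt0 w_le dy_le.
set v := hadamard _ _ in v_le; set g := \sum_i _ in g_ge g_le.
have v0 := norm2_ge0 v.
have d2 : delta ^+ 2 <= t ^+ 2 / 8100 by rewrite tE.
have dNt : delta * (N * t) <= N * t ^+ 2 / 90.
  apply: le_trans (ler_wpM2r Nt0 dt) _; clearbody N t; clear; lra.
have NM : M <= N * M by rewrite ler_peMl// ltW.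
have NNM : N * M <= N ^+ 2 * M.
  by rewrite expr2 -mulrA ler_peMl// (le_trans (ltW M0)).
(* [10/7 (1/4 + 1/90 + 1/8100) < 25/64]; since [16 * 25/64 = (5/2)^2], this yields
   [alpha >= (2/5) / N]. *)
have v_le' : norm2 v <= 25 / 64 * (N ^+ 2 * M).
  apply: (le_trans v_le); move: dNt d2 NM NNM M0; rewrite exprMn tE.
  by clearbody N M; clear; lra.
have alphaE : alpha = if v == 0 then 1 / 2 else
  Num.min (1 / 2) (Num.sqrt (M / (16 * norm2 v))) by [].
have a_ge : 2 / 5 / N <= alpha.
  have Nh : 2 / 5 / N <= 1 / 2.
    rewrite ler_pdivrMr ?(lt_le_trans ltr01 N1)//.
    by clearbody N; clear -N1; lra.
  rewrite alphaE; case: eqP => // /eqP /norm2_gt0 vp.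
  rewrite le_min Nh/= -(@ler_pXn2r _ 2)// ?nnegrE ?sqrtr_ge0//; last first.
    by rewrite !divr_ge0 ?(le_trans ler01 N1).
  rewrite sqr_sqrtr; last by rewrite divr_ge0 ?(ltW M0) ?mulr_ge0.
  rewrite ler_pdivlMr ?mulr_gt0// expr_div_n mulrAC ler_pdivrMr; last first.
    by rewrite exprn_gt0// (lt_le_trans ltr01 N1).
  rewrite expr_div_n (mulrC M).
  by clear -v_le'; lra.
have a_le : alpha <= 1 / 2.
  by rewrite alphaE; case: ifP => // _; rewrite ge_min lexx.
have a0 : 0 <= alpha.
  by apply: le_trans a_ge; rewrite !divr_ge0 ?(le_trans ler01 N1).
have av : alpha ^+ 2 * norm2 v <= M / 16.
  have [->|v_neq0] := eqVneq v 0.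
    by rewrite norm2_0 mulr0 divr_ge0 ?(ltW M0).
  have vp := norm2_gt0 v_neq0.
  have : alpha <= Num.sqrt (M / (16 * norm2 v)).
    by rewrite alphaE (negbTE v_neq0) ge_min lexx orbT.
  rewrite -(@ler_pXn2r _ 2)// ?nnegrE ?sqrtr_ge0//.
  rewrite sqr_sqrtr; last by rewrite divr_ge0 ?(ltW M0) ?mulr_ge0.
  rewrite ler_pdivlMr ?mulr_gt0// => h.
  by clear -h; lra.
have n0 : 0 < n%:R :> R by rewrite ltr0n.
set q := g / n%:R.
have q_le : q <= M / 90.
  rewrite /q ler_pdivrMr// -NE; rewrite tE in dNt.
  by clear -dNt NNM g_le; clearbody N; lra.
have q_ge : - (91 / 8100 * M) <= q.
  rewrite /q ler_pdivlMr// -NE; rewrite tE in dNt d2.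
  by clear -dNt d2 NM NNM g_ge M0; lra.
have a2 : alpha ^+ 2 <= alpha / 2.
  by rewrite expr2 ler_wpM2l// -[2^-1]mul1r.
have a2_ge0 : 0 <= alpha ^+ 2 by rewrite sqr_ge0.
have a2M : alpha ^+ 2 * M <= alpha * M / 2.
  by have := ler_wpM2r (ltW M0) a2; clear; lra.
have aM : alpha * M <= M / 2 by have := ler_wpM2r (ltW M0) a_le; clear; lra.
have aq_ge := ler_wpM2l a2_ge0 q_ge; have aq_le := ler_wpM2l a2_ge0 q_le.
have muE : mu z' = (1 - alpha) * M + alpha ^+ 2 * q.
  by rewrite /z' mu_move// -/M -/g mulr0 addr0.
have [x'0 s'0] : vpos (px z') /\ vpos (ps z').
  (* For [u <= alpha <= 1/2] the product is at least [(1/2) (3/4) M - M / 16 > 0]. *)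
  apply: move_pos => // i u /andP[u0 ua].
  rewrite mulr0 mul0r addr0.
  have := nbhd2_xs i zN; rewrite -/M; set xs := _ * ps z i 0 => xs_ge.
  have := norm2_ge_coord v i; rewrite /v mxE -/v.
  set vi := step_x _ _ _ _ _ _ * _.
  rewrite ler_norml => /andP[vi_ge _].
  have u2 : u ^+ 2 <= alpha ^+ 2 by rewrite ler_pXn2r.
  have : - (M / 16) <= u ^+ 2 * vi.
    have := ler_wpM2l (sqr_ge0 u) vi_ge; have := ler_wpM2r v0 u2.
    by clear -av; lra.
  move=> uvi; have half_le : 1 / 2 <= 1 - u by clear -ua a_le; lra.
  have xs_ge' : 3 / 4 * M <= xs by clear -xs_ge; lra.
  have M34 : 0 <= 3 / 4 * M by clear -M0; lra.
  have h := ler_pM (divr_ge0 ler01 (ler0n _ 2)) M34 half_le xs_ge'.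
  by clear -h uvi M0; lra.
split.
- split=> //.
  have a1 : alpha <= 1 by clear -a_le; lra.
  apply: le_trans (move_dev A x0 s0 _ _ n_gt0 _) _; first by rewrite a0.
  rewrite muE.
  have : (1 - alpha) * norm2 (hadamard (px z) (ps z) - const_mx (mu z))
      <= (1 - alpha) * (1 / 4 * M) by rewrite ler_wpM2l ?subr_ge0.
  (* The radius gains [(1 - alpha) M / 4 >= M / 8] over the old deviation term; this pays for
     [M / 16] and for a slightly negative [q]. *)
  rewrite -/v => h; clear -h av aq_ge a2M aM M0; lra.
- by rewrite a_ge.
- rewrite muE; clear -aq_le a2M; lra.
- rewrite muE; clear -aq_ge aM a2M M0; lra.
Qed.

(** The increase of [mu] keeps its factor [1 / n], because it has to be dominated by a predictor
    gain that may be only of order [mu / sqrt n]. *)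
Lemma corrector_step (R : realType) m n (A : 'M[R]_(m, n))
    (z : lp_point R m n) (delta : R) (dy : 'cV[R]_m) :
  (0 < n)%N -> row_free A -> 0 <= delta ->
  nbhd2 (1 / 2) z -> delta ^+ 2 <= mu z / 3528 ->
  norm_mx (normal_mx A z) (dy - invmx (normal_mx A z) *m normal_rhs A 1 z)
    <= delta ->
  nbhd2 (1 / 4) (corrector_move A z dy) /\
  mu (corrector_move A z dy)
    <= mu z + delta * Num.sqrt (mu z / 2) / n%:R.
Proof.
move=> n_gt0 hA delta_ge0 zN delta_le dy_le; have [dev x0 s0] := zN.
rewrite /corrector_move; set z' := move _ _ _ _ _.
have M0 := mu_gt0 x0 s0 n_gt0; set M := mu z in M0 *.
pose r := Num.sqrt (M / 2).
have r0 : 0 <= r by exact: sqrtr_ge0.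
have rE : r ^+ 2 = M / 2 by rewrite sqr_sqrtr// divr_ge0 ?(ltW M0).
have dr : delta <= r / 42.
  rewrite -(@ler_pXn2r _ 2)// ?nnegrE ?divr_ge0//.
  by rewrite expr_div_n rE; move: delta_le; rewrite -/M; clear; lra.
have xs_gt0 i : 0 < px z i 0 * ps z i 0 by rewrite mulr_gt0.
(* The numerators sum to at most [(M / 2)^2] and each denominator is at least [M / 2], so
   [rho^2 = M / 2]. *)
have w_le : \sum_i (px z i 0 * ps z i 0 - 1 * M) ^+ 2 / (px z i 0 * ps z i 0)
    <= r ^+ 2.
  have : \sum_i (px z i 0 * ps z i 0 - 1 * M) ^+ 2 <= (M / 2) ^+ 2.
    rewrite (eq_bigr (fun i =>
        (hadamard (px z) (ps z) - const_mx M) i 0 ^+ 2)) => [|i _].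
      rewrite -sqr_norm2 ler_pXn2r// ?nnegrE ?norm2_ge0 ?(divr_ge0 (ltW M0))//.
      by move: dev; rewrite -/M; clear; lra.
    by rewrite mul1r !mxE.
  move=> h; apply: (@le_trans _ _ ((M / 2) ^+ 2 / (M / 2))); last first.
    by rewrite rE expr2 mulfK// gt_eqF// divr_gt0.
  apply: (@le_trans _ _ (\sum_i (px z i 0 * ps z i 0 - 1 * M) ^+ 2 / (M / 2))).
    apply: ler_sum => i _; apply: ler_wpM2l; first exact: sqr_ge0.
    rewrite lef_pV2 ?posrE ?(divr_gt0 M0)//.
    by have := nbhd2_xs i zN; rewrite -/M; clear; lra.
  by rewrite -mulr_suml ler_wpM2r// invr_ge0 divr_ge0 ?(ltW M0).
have v_le := norm2_step_le hA x0 s0 delta_ge0 r0 w_le dy_le.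
have /andP[g_ge g_le] := sum_step_bounds hA x0 s0 delta_ge0 r0 w_le dy_le.
set v := hadamard _ _ in v_le; set g := \sum_i _ in g_ge g_le.
have dr2 : delta * r <= M / 84.
  by have := ler_wpM2r r0 dr; rewrite mulrAC -expr2 rE; clear; lra.
rewrite -/M in delta_le.
(* [10/7 (1/8 + 1/84 + 1/3528) < 1/5], which stays below a quarter of the new [mu], at least
   [49/50 M]. *)
have v_le' : norm2 v <= M / 5.
  by move: v_le; rewrite rE; clear -delta_le dr2 M0; lra.
have n1 : 1 <= n%:R :> R by rewrite ler1n.
have n0 : 0 < n%:R :> R by rewrite ltr0n.
set q := g / n%:R.
have q_le : q <= delta * r / n%:R by rewrite ler_pM2r ?invr_gt0.
have q_ge : - (M / 50) <= q.
  rewrite ler_pdivlMr// mulNr.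
  have : M / 50 * 1 <= M / 50 * n%:R by rewrite ler_wpM2l// divr_ge0 ?(ltW M0).
  by clear -g_ge dr2 delta_le M0; lra.
have muE : mu z' = M + q.
  by rewrite /z' mu_move// -/M -/g expr1n !mul1r subrr add0r mul1r.
have [x'0 s'0] : vpos (px z') /\ vpos (ps z').
  apply: move_pos => // i u /andP[u0 u1].
  have := nbhd2_xs i zN; rewrite -/M; set xs := _ * ps z i 0 => xs_ge.
  have := norm2_ge_coord v i; rewrite /v mxE -/v.
  set vi := step_x _ _ _ _ _ _ * _.
  rewrite ler_norml => /andP[vi_ge _].
  have uv : - (u * (M / 5)) <= u ^+ 2 * vi.
    have h1 := ler_wpM2l (sqr_ge0 u) vi_ge.
    have h2 := ler_wpM2l (sqr_ge0 u) v_le'.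
    have h3 : u ^+ 2 * (M / 5) <= u * (M / 5).
      by rewrite ler_wpM2r ?(divr_ge0 (ltW M0))// expr2 ler_piMl.
    by clear -h1 h2 h3; lra.
  have h : (1 - u) * ((1 - 1 / 2) * M) <= (1 - u) * xs.
    by rewrite ler_wpM2l ?subr_ge0.
  have uM : 0 <= u * M by rewrite mulr_ge0 ?(ltW M0).
  by clear -h uv uM M0; lra.
split; last by rewrite muE lerD2l.
split=> //.
apply: le_trans (move_dev A x0 s0 _ _ n_gt0 _) _; first by rewrite ler01 lexx.
rewrite muE subrr mul0r add0r expr1n mul1r.
by apply: le_trans v_le' _; clear -q_ge M0; lra.
Qed.

(** * Numerical bounds on [ln 2] and [C0] *)

Lemma ln2_ge_half (R : realType) : 1 / 2 <= ln (2 : R).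
Proof.
have : ln (1 + - (1 / 2) : R) <= - (1 / 2) by apply: le_ln1Dx; lra.
have -> : 1 + - (1 / 2) = 2^-1 :> R by field.
by rewrite lnV ?posrE//; lra.
Qed.

(* With no constraint and one variable the predictor step halves mu. *)
Lemma predictor_decrease_le_half (R : realType) (C0 : R) :
  predictor_decrease C0 -> C0 <= 1 / 2.
Proof.
pose z : lp_point R 0 1 := LpPoint (const_mx 1) 0 (const_mx 1).
have muz : mu z = 1 by rewrite /mu dotE big_ord1 !mxE mulr1 divr1.
have zN : nbhd2 (1 / 4) z.
  split; [|by move=> i; rewrite mxE|by move=> i; rewrite mxE].
  rewrite muz (_ : _ - _ = 0) ?norm2_0; first lra.
  by apply/matrixP => i j; rewrite !mxE mulr1 subrr.
have A0 : row_free (0 : 'M[R]_(0, 1)) by rewrite /row_free -leqn0 rank_leq_row.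
have res0 : residual 0 0 z 0 = 0 by apply/matrixP => -[].
move=> /(_ _ _ _ z 0 isT A0 zN); rewrite res0 mulmx0 norm2_0.
move=> /(_ (divr_ge0 (sqrtr_ge0 _) (ler0n _ _))).
have s0 : step_s (0 : 'M[R]_(0, 1)) 0 = 0 by rewrite /step_s mulmx0 oppr0.
have v0 : hadamard (step_x 0 0 z 0) (step_s (0 : 'M[R]_(0, 1)) 0) = 0.
  by rewrite s0; apply/matrixP => i j;
    rewrite [LHS]mxE [X in _ * X]mxE mulr0 mxE.
(* Here [dx o ds = 0], so [alpha] takes its default [1 / 2], and [mu] drops from 1 to [1 / 2]. *)
rewrite /predictor_move /predictor_alpha v0 eqxx.
rewrite (mu_move 0 _ _ _ _ _ (ltn0Sn 0)); last 2 first.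
- by case: zN.
- by case: zN.
rewrite big1 => [|i _]; last by rewrite s0 [X in _ * X]mxE mulr0.
rewrite muz sqrtr1; lra.
Qed.

(** * Feasibility drift and the outer iteration *)

Lemma mulmx_move (R : realType) m n (A : 'M[R]_(m, n)) sigma alpha
    (z : lp_point R m n) dy delta :
  vpos (px z) -> vpos (ps z) -> 0 <= alpha ->
  norm2 (normal_mx A z *m dy - normal_rhs A sigma z) <= delta ->
  norm2 (A *m px (move A sigma alpha z dy) - A *m px z) <= alpha * delta.
Proof.
move=> x0 s0 alpha0 r_le.
rewrite /= mulmxDr addrAC subrr add0r -scalemxAr norm2Z ger0_norm//.
by rewrite ler_wpM2l// mulmx_step_x norm2N -norm2N opprB.
Qed.

Lemma dual_move (R : realType) m n (A : 'M[R]_(m, n)) sigma alpha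
    (z : lp_point R m n) dy :
  A^T *m py (move A sigma alpha z dy) + ps (move A sigma alpha z dy)
    = A^T *m py z + ps z.
Proof.
by rewrite /= /step_s mulmxDr -scalemxAr scalerN addrACA subrr addr0.
Qed.

(** Only the range of the predictor length [a] is retained: [0 <= a] serves to count iterations,
    [a <= 1/2] to bound the cost of the last one. *)
Lemma outer_step (R : realType) m n (A : 'M[R]_(m, n))
    (solve : nat -> 'M[R]_m -> 'cV[R]_m -> R -> 'cV[R]_m)
    (delta eps : R) k (z : lp_point R m n) :
  (0 < n)%N -> row_free A -> is_solver A solve ->
  0 < eps -> 0 < delta -> delta <= Num.sqrt eps / 2 ^+ 6 ->
  nbhd2 (1 / 4) z -> 2 * eps <= mu z ->
  let z' := outer_iteration A solve delta k z in
  [/\ nbhd2 (1 / 4) z',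
      A^T *m py z' + ps z' = A^T *m py z + ps z &
      exists2 a, 0 <= a <= 1 / 2 &
        norm2 (A *m px z' - A *m px z) <= (1 + a) * delta /\
        1 + a <= 15 / 4 * Num.sqrt n%:R * (ln (mu z) - ln (mu z'))].
Proof.
move=> n_gt0 hA hsolve eps0 delta0 delta_le zN z_ge.
rewrite /outer_iteration; cbv zeta; set dy := solve k.*2 _ _ _.
have d2 : delta ^+ 2 <= eps / 4096.
  have -> : eps / 4096 = (Num.sqrt eps / 2 ^+ 6) ^+ 2.
    by rewrite expr_div_n sqr_sqrtr ?ltW// -exprM; congr (_ / _); ring.
  by rewrite ler_pXn2r// nnegrE ?(ltW delta0) ?divr_ge0 ?sqrtr_ge0 ?exprn_ge0.
have [_ x0 s0] := zN.
have [dyM dyr] := hsolve k.*2 z (normal_rhs A 0 z) delta x0 s0 delta0.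
rewrite -/dy in dyM dyr.
have d2z : delta ^+ 2 <= mu z / 8100 by clear -d2 z_ge eps0; lra.
have := predictor_step n_gt0 hA (ltW delta0) zN d2z dyM.
set a := predictor_alpha A z dy; set z' := predictor_move A z dy => -[z'N].
move=> /andP[a_ge a_le] mu_le mu_ge.
set dy' := solve k.*2.+1 _ _ _.
have [_ x'0 s'0] := z'N.
have [dyM' dyr'] := hsolve k.*2.+1 z' (normal_rhs A 1 z') delta x'0 s'0 delta0.
rewrite -/dy' in dyM' dyr'.
(* [delta^2 <= mu z / 8192] and [mu z' >= 7/16 mu z] give [mu z' / 3584]. *)
have d2z' : delta ^+ 2 <= mu z' / 3528 by clear -d2 z_ge mu_ge eps0; lra.
have := corrector_step n_gt0 hA (ltW delta0) z'N d2z' dyM'.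
set z'' := corrector_move A z' dy' => -[z''N mu''_le].
pose N : R := Num.sqrt n%:R.
have N1 : 1 <= N by rewrite -sqrtr1 ler_wsqrtr// ler1n.
have N0 : 0 < N by apply: lt_le_trans N1.
have Na : 2 / 5 <= a * N by move: a_ge; rewrite ler_pdivrMr.
have a0 : 0 < a by rewrite -(pmulr_lgt0 _ N0) (lt_le_trans _ Na) ?divr_gt0.
have [_ x''0 s''0] := z''N.
have M0 := mu_gt0 x0 s0 n_gt0; have M''0 := mu_gt0 x''0 s''0 n_gt0.
split => //.
  by rewrite /z'' /corrector_move dual_move /z' /predictor_move dual_move.
exists a; first by rewrite (ltW a0).
split.
  have h1 := mulmx_move x0 s0 (ltW a0) dyr.
  have h2 := mulmx_move x'0 s'0 ler01 dyr'.
  rewrite (_ : A *m px z'' - A *m px z =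
    (A *m px z'' - A *m px z') + (A *m px z' - A *m px z)); last first.
    by rewrite addrA subrK.
  by apply: le_trans (ler_norm2D _ _) _; rewrite mulrDl; exact: lerD.
have decr : mu z'' <= mu z * (1 + - (14 / 15 * a)).
  have dr : delta * Num.sqrt (mu z' / 2) <= mu z / 128.
    have mz' : 0 <= mu z' / 2 by rewrite divr_ge0 ?(ltW (mu_gt0 x'0 s'0 n_gt0)).
    rewrite -(@ler_pXn2r _ 2)// ?nnegrE ?(divr_ge0 (ltW M0))//; last first.
      by rewrite mulr_ge0 ?sqrtr_ge0 ?ltW.
    rewrite exprMn sqr_sqrtr//.
    have mz'M : mu z' / 2 <= mu z / 2.
      have := mulr_gt0 a0 M0; clear -mu_le; lra.
    have d2z4 : delta ^+ 2 <= mu z / 8192 by clear -d2 z_ge eps0; lra.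
    have := ler_pM (sqr_ge0 _) mz' d2z4 mz'M.
    by clear; lra.
  have n0 : 0 < n%:R :> R by rewrite ltr0n.
  (* [1 <= 5/2 * a * N <= 5/2 * a * n] trades the division by [n] for a factor [a]. *)
  have drn : delta * Num.sqrt (mu z' / 2) / n%:R <= 5 / 256 * (a * mu z).
    rewrite ler_pdivrMr//; apply: (le_trans dr).
    have h1 : 2 / 5 * mu z <= a * N * mu z by rewrite ler_wpM2r ?(ltW M0).
    have h2 : a * N * mu z <= a * mu z * n%:R.
      have <- : N ^+ 2 = n%:R by rewrite sqr_sqrtr.
      rewrite -subr_ge0.
      have -> : a * mu z * N ^+ 2 - a * N * mu z
        = a * mu z * (N * (N - 1)) by ring.
      by apply: mulr_ge0; apply: mulr_ge0; rewrite ?subr_ge0// ltW.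
    by clear -h1 h2; lra.
  (* [179/180 - 5/256 >= 14/15]. *)
  have := mulr_gt0 a0 M0; clear -mu''_le drn mu_le; lra.
have la : ln (1 + - (14 / 15 * a)) <= - (14 / 15 * a).
  by apply: le_ln1Dx; clear -a_le; lra.
have f0 : 0 < 1 + - (14 / 15 * a) by clear -a_le; lra.
have lnd : ln (mu z'') <= ln (mu z) - 14 / 15 * a.
  have : ln (mu z'') <= ln (mu z * (1 + - (14 / 15 * a))).
    by rewrite ler_ln// ?posrE// mulr_gt0.
  by rewrite lnM ?posrE//; clear -la; lra.
have h : N * (14 / 15 * a) <= N * (ln (mu z) - ln (mu z'')).
  by rewrite ler_wpM2l ?(ltW N0)//; clear -lnd; lra.
have aN : a <= a * N by rewrite ler_peMr// ltW.
(* [15/4 * 14/15 = 5/2 + 1]: the part [5/2 * a * N] covers 1, and [a * N] covers [a]. *)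
by rewrite -/N; clear -h aN Na; lra.
Qed.

(** * Telescoping over the outer iterations *)

Theorem theorem1 (R : realType) (C0 : R) (hC0 : 0 < C0 < 1)
    (hdec : predictor_decrease C0) :
  exists C : R, 0 < C /\
    forall (m n : nat) (A : 'M[R]_(m, n)) (b : 'cV[R]_m) (c : 'cV[R]_n)
      (eps : R) (z0 : lp_point R m n)
      (solve : nat -> 'M[R]_m -> 'cV[R]_m -> R -> 'cV[R]_m),
      (m <= n)%N -> row_free A -> 0 < eps ->
      nbhd2 (1 / 4) z0 ->
      A *m px z0 = b -> A^T *m py z0 + ps z0 = c ->
      2 * eps <= mu z0 ->
      is_solver A solve ->
      exists (K : nat) (z : lp_point R m n),
        terminates_at A solve (tolerance C0 eps (mu z0) n) eps z0 K z /\
        K%:R <= C * Num.sqrt n%:R * ln (mu z0 / eps) /\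
        A^T *m py z + ps z = c /\
        vnneg (ps z) /\
        mu z < 2 * eps /\
        norm2 (A *m px z - b) < eps.
Proof.
exists (15 / 4); split; first lra.
move=> m n A b c eps z0 solve _ hA eps0 z0N pz0 dz0 mz0 hsolve.
(* For [n = 0], [mu z0] is 0 by the convention on division by zero. *)
have n_gt0 : (0 < n)%N.
  rewrite lt0n; apply: contraTneq mz0 => /(congr1 (fun k => k%:R : R)) n0.
  by rewrite /mu n0 invr0 mulr0 -ltNge mulr_gt0.
pose N : R := Num.sqrt n%:R.
have N1 : 1 <= N by rewrite -sqrtr1 ler_wsqrtr// ler1n.
have N0 : 0 < N by apply: lt_le_trans N1.
have M0 : 0 < mu z0 by apply: lt_le_trans mz0; rewrite mulr_gt0.
set delta := tolerance C0 eps (mu z0) n.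
pose L := ln (mu z0 / eps).
have LE : L = ln (mu z0) - ln eps by rewrite /L ln_div.
have ln2 := ln2_ge_half R.
have ln2eps : ln (2 * eps) = ln 2 + ln eps by rewrite lnM ?posrE.
have L_ge : ln 2 <= L.
  have : ln (2 * eps) <= ln (mu z0) by rewrite ler_ln ?posrE ?(mulr_gt0 _ eps0).
  by clear -LE ln2eps; lra.
have L0 : 0 < L by clear -L_ge ln2; lra.
have [C00 C01] := andP hC0.
have C0_half := predictor_decrease_le_half hdec.
have delta0 : 0 < delta.
  rewrite lt_min divr_gt0 ?sqrtr_gt0 ?exprn_gt0//=.
  by rewrite divr_gt0 ?mulr_gt0.
have delta_le1 : delta <= Num.sqrt eps / 2 ^+ 6 by rewrite ge_min lexx.
have delta_le2 : delta * (N * L) <= eps / 4.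
  have : delta <= eps * C0 / (2 * N * L) by rewrite ge_min lexx orbT.
  rewrite ler_pdivlMr ?mulr_gt0// => h.
  have := ler_wpM2l (ltW eps0) C0_half; clear -h; lra.
pose z k := iterates A solve delta z0 k.
have step k := outer_step k n_gt0 hA hsolve eps0 delta0 delta_le1.
have zS k : z k.+1 = outer_iteration A solve delta k (z k) by [].
(* Both bounds are measured by the total drop of [ln mu], since each iteration costs at least 1 and
   moves [A x] by at most its cost times [delta]. *)
have inv k : (forall j, (j < k)%N -> 2 * eps <= mu (z j)) ->
    [/\ nbhd2 (1 / 4) (z k), A^T *m py (z k) + ps (z k) = c,
        norm2 (A *m px (z k) - b)
          <= 15 / 4 * N * (ln (mu z0) - ln (mu (z k))) * delta &
        k%:R <= 15 / 4 * N * (ln (mu z0) - ln (mu (z k)))].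
  elim: k => [_|k IH big_mu].
    by rewrite /z /= pz0 !subrr norm2_0 mulr0 mul0r.
  have [|zN dz pz kz] := IH; first by move=> j jk; apply: big_mu; exact: ltnW.
  have [z'N dz' [a /andP[a0 a_le] [pz' az]]] :=
    step (z k) k zN (big_mu k (leqnn _)).
  rewrite zS; set z' := outer_iteration _ _ _ _ _ in z'N dz' pz' az *.
  split => //; first by rewrite dz' dz.
    rewrite (_ : A *m px z' - b = (A *m px z' - A *m px (z k))
      + (A *m px (z k) - b)); last by rewrite addrA subrK.
    apply: le_trans (ler_norm2D _ _) _.
    have := ler_wpM2r (ltW delta0) az; rewrite -/N.
    by clear -pz pz'; lra.
  by rewrite -natr1; move: az; rewrite -/N; clear -kz a0; lra.
have ln_mu k : 2 * eps <= mu (z k) -> ln 2 + ln eps <= ln (mu (z k)).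
  move=> h; rewrite -ln2eps ler_ln ?posrE ?(mulr_gt0 _ eps0)//.
  by apply: lt_le_trans h; rewrite mulr_gt0.
have [K K_lt K_min] : exists2 K, mu (z K) < 2 * eps &
    forall j, (j < K)%N -> 2 * eps <= mu (z j).
  have [K K_lt] : exists K, mu (z K) < 2 * eps.
    (* Without termination every [k] would be at most [15/4 * N * L], against the Archimedean
       property. *)
    apply: contrapT => /forallNP noK.
    have big_mu j : 2 * eps <= mu (z j) by rewrite leNgt; apply/negP.
    have c0 : 0 <= 15 / 4 * N by clear -N0; lra.
    have B0 := mulr_ge0 c0 (ltW L0).
    have [_ _ _] := inv (Num.bound (15 / 4 * N * L)) (fun j _ => big_mu j).
    apply/negP; rewrite -ltNge; apply: le_lt_trans (archi_boundP B0).
    rewrite ler_wpM2l//.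
    have := ln_mu _ (big_mu (Num.bound (15 / 4 * N * L))).
    by clear -LE ln2; lra.
  have exK : exists K, mu (z K) < 2 * eps by exists K.
  case: (ex_minnP exK) => j j_lt j_min; exists j => // i ij.
  by rewrite leNgt; apply: contraL ij => /j_min; rewrite -leqNgt.
(* At least one iteration is performed; the invariant is read at the last iterate with
   [mu >= 2 * eps]. *)
case: K K_lt K_min => [|k]; first by rewrite ltNge mz0.
move=> K_lt K_min.
have [|zN dz pz kz] := inv k; first by move=> j jk; apply: K_min; exact: ltnW.
have mzk := K_min k (leqnn _).
have [z'N dz' [a /andP[a0 a_le] [pz' _]]] := step (z k) k zN mzk.
rewrite -zS in z'N dz' pz'.
have lnk : N * (ln (mu z0) - ln (mu (z k))) <= N * L - N * ln 2.
  by rewrite -mulrBr ler_wpM2l ?(ltW N0)//; have := ln_mu _ mzk; clear -LE; lra.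
(* The last iteration, whose mu may be far below 2 eps, is paid for by the
   slack ln 2 between mu0 / eps and mu0 / (2 eps). *)
have last_it : 15 / 4 * N * (ln (mu z0) - ln (mu (z k))) + 3 / 2
    <= 15 / 4 * (N * L).
  (* [N * ln 2 >= 1/2], so the slack is at least [15/8 > 3/2], the largest value of [1 + a]. *)
  have := ler_pM ler01 (divr_ge0 ler01 (ler0n _ 2)) N1 ln2.
  by clear -lnk; lra.
exists k.+1, (z k.+1); split; first by split.
split.
  by rewrite -natr1 -/N -/L; clear -kz last_it; lra.
split; first by rewrite dz' dz.
split; first by case: z'N => _ _ h i; exact: ltW.
split=> //.
rewrite (_ : A *m px (z k.+1) - b = (A *m px (z k.+1) - A *m px (z k))
      + (A *m px (z k) - b)); last by rewrite addrA subrK.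
apply: le_lt_trans (ler_norm2D _ _) _.
have h1 := ler_wpM2r (ltW delta0) last_it.
have h2 : (1 + a) * delta <= 3 / 2 * delta.
  by rewrite ler_wpM2r ?(ltW delta0)//; clear -a_le; lra.
(* The total drift is at most [15/4 * N * L * delta <= 15/16 * eps]. *)
by clear -h1 h2 pz pz' delta_le2 eps0; lra.
Qed.
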